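(* For every integer $n\ge 3$, the graph $G_n$ defined in the context satisfies $\overline{\gamma_P}(G_n)=\gamma_P(G_n)=n-1$ and $\underline{pd_0}(G_n)=pd_0(G_n)=2n-2>\overline{\gamma_P}(G_n)+1=\gamma_P(G_n)+1$.
   Context: Graphs are finite and simple. For a graph $G$ and a non-empty $S\subseteq V(G)$ define $P^0[S]=S$, $P^1[S]=N[S]$ (the union of the closed neighborhoods of vertices of $S$), and for $i\ge 2$, $P^i[S]=P^{i-1}[S]\cup\{u: N_G(v)\setminus P^{i-1}[S]=\{u\}\text{ for some }v\in P^{i-1}[S]\}$. $S$ is a power dominating set if $P^t[S]=V(G)$ for some $t$. $\gamma_P(G)$ is the minimum cardinality of a power dominating set, and $\overline{\gamma_P}(G)$ is the maximum cardinality of a minimal (with respect to inclusion) power dominating set. The graph $\mathcal{PD}^{TAR}_k(G)$ has as vertices all power dominating sets of $G$ of cardinality at most $k$, two of them adjacent if and only if one is obtained from the other by adding or removing a single vertex; it is considered for $k\ge\gamma_P(G)$. $pd_0(G)$ is the least $k_0$ such that $\mathcal{PD}^{TAR}_k(G)$ is connected for all $k\ge k_0$, and $\underline{pd_0}(G)$ is the least $k$ such that $\mathcal{PD}^{TAR}_k(G)$ is connected (both over values at least $\gamma_P(G)$). For $n\ge 3$, the graph $G_n$ has vertex set $T_n\cup\bigcup_{i=1}^n S_{n,i}$ (disjoint union), where $T_n=\{u_1,\dots,u_{n-1}\}$ and $S_{n,i}=\{v^i_1,\dots,v^i_n\}$ for $1\le i\le n$. Its adjacencies are, for $i=1,\dots,n$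 and $j=1,\dots,n-1$: $N_{G_n}(v^i_j)=\{u_j\}\cup\{v^i_p:1\le p\le n,\ p\ne j\}$, $N_{G_n}(v^i_n)=\{v^i_1,\dots,v^i_{n-1}\}$, and $N_{G_n}(u_j)=\{v^r_j:1\le r\le n\}$. *)

(* Defs.v *)
From HB Require Import structures.
From mathcomp Require Import all_boot.
From mathcomp Require Import boolp.

Set Implicit Arguments.
Unset Strict Implicit.
Unset Printing Implicit Defensive.

Record sgraph := SGraph {
  vertex :> finType;
  edge : rel vertex;
  edge_sym : symmetric edge;
  edge_irr : irreflexive edge
}.

Definition nbhd (G : sgraph) (v : G) : {set G} := [set w | edge v w].

Definition closed_nbhd (G : sgraph) (v : G) : {set G} := v |: nbhd v.

Definition connected_graph (G : sgraph) : bool :=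
  [forall x : G, forall y : G, connect (@edge G) x y].

Definition force_step (G : sgraph) (A : {set G}) : {set G} :=
  A :|: [set u | [exists v in A, nbhd v :\: A == [set u]]].

Fixpoint observed (G : sgraph) (S : {set G}) (i : nat) : {set G} :=
  match i with
  | 0 => S
  | 1 => \bigcup_(v in S) closed_nbhd v
  | i'.+1 => force_step (observed S i')
  end.

Definition pd_set (G : sgraph) (S : {set G}) : bool :=
  (S != set0) && `[< exists t, observed S t = [set: G] >].

(* The default [set: G] only matters for the graph without vertices. *)
Definition gammaP (G : sgraph) : nat :=
  #|[arg min_(S < [set: G] | pd_set S) #|S|]|.

Definition upper_gammaP (G : sgraph) : nat :=
  \max_(S : {set G} | minset (@pd_set G) S) #|S|.

Definition tar_vertex (G : sgraph) (k : nat) : finType :=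
  {S : {set G} | pd_set S && (#|S| <= k)}.

Definition tar_edge (G : sgraph) (k : nat) : rel (tar_vertex G k) :=
  fun A B => [exists x, (x \notin val A) && (val B == x |: val A)]
          || [exists x, (x \in val A) && (val B == val A :\ x)].

Lemma tar_edge_sym (G : sgraph) (k : nat) : symmetric (@tar_edge G k).
Proof.
have H (A B : tar_vertex G k) : tar_edge A B -> tar_edge B A.
  case/orP=> /existsP[x /andP[xA /eqP eB]]; apply/orP; [right|left];
    apply/existsP; exists x; rewrite eB.
    by rewrite setU11 setU1K ?eqxx.
  by rewrite setD11 setD1K ?eqxx.
by move=> A B; apply/idP/idP; apply: H.
Qed.

Lemma tar_edge_irr (G : sgraph) (k : nat) : irreflexive (@tar_edge G k).
Proof.
move=> A; apply/negP => /orP[] /existsP[x /andP[xA /eqP eA]].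
  by move: xA; rewrite eA setU11.
by move: xA; rewrite eA setD11.
Qed.

Definition TAR (G : sgraph) (k : nat) : sgraph :=
  SGraph (@tar_edge_sym G k) (@tar_edge_irr G k).

Lemma force_stepS (G : sgraph) (A B : {set G}) :
  A \subset B -> force_step A \subset force_step B.
Proof.
move=> sAB; apply/subsetP => u; rewrite !in_setU.
case: (boolP (u \in B)) => // uB /orP[/(subsetP sAB)|]; first by rewrite (negPf uB).
rewrite !in_set => /existsP[v /andP[vA /eqP e]] /=.
apply/existsP; exists v; rewrite (subsetP sAB) // eqEsubset.
have -> : nbhd v :\: B \subset [set u] by rewrite -e setDS.
rewrite sub1set in_setD uB /=.
have : u \in nbhd v :\: A by rewrite e set11.
by rewrite inE => /andP[].
Qed.

Lemma observedS (G : sgraph) (S T : {set G}) i :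
  S \subset T -> observed S i \subset observed T i.
Proof.
move=> sST; elim: i => [|[|i] IH]; first exact: sST.
  apply/bigcupsP => v vS.
  by apply: bigcup_sup; apply: (subsetP sST).
exact: force_stepS IH.
Qed.

Lemma pd_setS (G : sgraph) (S T : {set G}) :
  S \subset T -> pd_set S -> pd_set T.
Proof.
move=> sST /andP[S0 /asboolP[t et]]; apply/andP; split.
  by apply: contraNneq S0 => T0; rewrite -subset0 -T0.
by apply/asboolP; exists t; apply/eqP; rewrite -subTset -et observedS.
Qed.

Lemma TAR_connected (G : sgraph) (k : nat) :
  #|G| <= k -> connected_graph (TAR G k).
Proof.
move=> Gk.
have le_k (S : {set G}) : #|S| <= k by apply: leq_trans (max_card _) Gk.
have top (A B : TAR G k) : val B = setT -> connect (@edge (TAR G k)) A B.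
  move=> BT; move: {2}#|~: val A| (leqnn #|~: val A|) => m.
  elim: m A => [|m IH] A cA.
    suff -> : A = B by apply: connect0.
    apply: val_inj; rewrite BT -[val A]setCK.
    by move: cA; rewrite leqn0 cards_eq0 => /eqP ->; rewrite setC0.
  have [AT|[x]] := set_0Vmem (~: val A).
    suff -> : A = B by apply: connect0.
    by apply: val_inj; rewrite BT -[val A]setCK AT setC0.
  rewrite inE => xA.
  have pA : pd_set (x |: val A) && (#|x |: val A| <= k).
    rewrite le_k andbT; have /andP[pA _] := valP A.
    by apply: pd_setS pA; apply: subsetUr.
  pose A' : TAR G k := exist _ (x |: val A) pA.
  apply: (@connect_trans _ _ A').
    apply: connect1; apply/orP; left; apply/existsP; exists x.
    by rewrite xA /=.
  apply: IH; rewrite -ltnS; apply: leq_trans cA; apply: proper_card.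
  by rewrite properC properUr // sub1set.
apply/'forall_forallP => A B.
have pT : pd_set [set: G] && (#|[set: G]| <= k).
  rewrite le_k andbT; have /andP[pA _] := valP A.
  by apply: pd_setS pA; apply: subsetT.
pose T : TAR G k := exist _ [set: G] pT.
have cs : connect_sym (@edge (TAR G k)).
  exact: (sym_connect_sym (@edge_sym (TAR G k))).
by apply: (@connect_trans _ _ T); [|rewrite cs]; apply: top.
Qed.

Lemma pd0_ex (G : sgraph) :
  exists k0, (gammaP G <= k0)
    && `[< forall k, k0 <= k -> connected_graph (TAR G k) >].
Proof.
exists #|G|; rewrite /gammaP max_card /=.
by apply/asboolP => k; apply: TAR_connected.
Qed.

Lemma lower_pd0_ex (G : sgraph) :
  exists k, (gammaP G <= k) && connected_graph (TAR G k).
Proof. by exists #|G|; rewrite /gammaP max_card /= TAR_connected. Qed.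

Definition pd0 (G : sgraph) : nat := ex_minn (pd0_ex G).

Definition lower_pd0 (G : sgraph) : nat := ex_minn (lower_pd0_ex G).

(* inl j is u_(j+1) and inr (i, j) is v^(i+1)_(j+1). In the cross adjacency the
   indices are compared as naturals, so inr (i, n-1) has no neighbour u_j. *)
Definition Gn_vertex (n : nat) : finType := ('I_(n.-1) + 'I_n * 'I_n)%type.

Definition Gn_edge (n : nat) : rel (Gn_vertex n) := fun x y =>
  match x, y with
  | inl _, inl _ => false
  | inl j, inr (_, p) => j == p :> nat
  | inr (_, p), inl j => p == j :> nat
  | inr (i, j), inr (r, p) => (i == r) && (j != p)
  end.

Lemma Gn_edge_sym (n : nat) : symmetric (@Gn_edge n).
Proof.
by move=> [j|[i j]] [l|[r p]] //=; rewrite (eq_sym i) (eq_sym j).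
Qed.

Lemma Gn_edge_irr (n : nat) : irreflexive (@Gn_edge n).
Proof. by move=> [j|[i j]] //=; rewrite !eqxx. Qed.

Definition Gn (n : nat) : sgraph := SGraph (@Gn_edge_sym n) (@Gn_edge_irr n).

(* Main.v *)
Require Import Defs.
From mathcomp Require Import all_boot.
From mathcomp Require Import boolp zify.

(** In G_n a set S is power dominating exactly when it contains the whole
    apex set T_n or meets all but at most one of the n cliques
    ([Gn_pd_setE]).

    These sets do power dominate: T_n dominates everything but the last vertex
    of each clique, and that vertex is then forced from inside its clique.  If
    S meets a clique, it observes the clique, whose vertices then force their
    apexes; once T_n and all cliques but one are observed, the apexes force
    the last clique.

    Conversely, suppose that S omits the apex u_a and misses two cliques r and
    s.  The four vertices v^r_a, v^r_n, v^s_a, v^s_n form a fort: a vertex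
    outside that has a neighbour among them has two, so none of the four can
    ever be the first to be forced ([fort_dominated]).  None is dominated by S
    either, since their closed neighbourhoods lie in the cliques r and s
    together with u_a.

    Hence every power dominating set contains one with exactly n - 1 elements,
    either T_n or a transversal of n - 1 cliques, and all minimal power
    dominating sets have that cardinality.

    In a TAR graph two sets are connected as soon as their union still fits
    under the bound k.  For k >= 2n - 2 this links T_n to every transversal, so
    the graph is connected.  For k < 2n - 2 a set that contains T_n has room for
    fewer than n - 1 other vertices, so it meets fewer than n - 1 cliques and no
    apex can be removed from it: the sets that contain T_n are cut off from the
    transversals. *)

(** * Observation and forts *)

Lemma observed_subS {G : sgraph} (S : {set G}) i :
  observed S i \subset observed S i.+1.
Proof.
case: i => [|i] /=; last exact: subsetUl.
apply/subsetP => x xS; apply/bigcupP; exists x => //.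
exact: setU11.
Qed.

Lemma observed_mono {G : sgraph} (S : {set G}) {i j} :
  i <= j -> observed S i \subset observed S j.
Proof.
move=> /subnK <-; elim: (j - i) => [|k IH]; first by rewrite add0n.
by rewrite addSn; apply: subset_trans IH (observed_subS _ _).
Qed.

(** Forgetting the time of observation turns the forcing rule into a closure
    rule ([monitored_force]), so that power domination can be derived without
    counting rounds. *)
Definition monitored {G : sgraph} (S : {set G}) (x : G) : Prop :=
  exists t, x \in observed S t.

(** Finiteness yields a common time; it is taken positive because round one is
    domination, and only later rounds apply the forcing rule. *)
Lemma monitored_uniform {G : sgraph} (S : {set G}) (P : pred G) :
  (forall x, P x -> monitored S x) ->
  exists t, forall x, P x -> x \in observed S t.+1.
Proof.
move=> h.
have /choice[f hf] (x : G) : exists t, P x -> x \in observed S t.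
  case Px: (P x); last by exists 0.
  by have [t xt] := h x Px; exists t.
exists (\max_x f x) => x Px.
apply: (subsetP (observed_mono _ (leqW (leq_bigmax x)))).
exact: hf.
Qed.

Lemma monitored_dom {G : sgraph} (S : {set G}) (x y : G) :
  y \in S -> x \in closed_nbhd y -> monitored S x.
Proof. by move=> yS xy; exists 1; apply/bigcupP; exists y. Qed.

Lemma monitored_force {G : sgraph} (S : {set G}) (v w : G) :
  monitored S v -> edge v w ->
  (forall x, edge v x -> x != w -> monitored S x) -> monitored S w.
Proof.
move=> mv vw mo.
have [x|t ht] := @monitored_uniform G S [pred x | (x == v) || edge v x && (x != w)].
  by case/orP=> [/eqP -> //|/andP[vx xw]]; apply: mo.
have [wt|wt] := boolP (w \in observed S t.+1); first by exists t.+1.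
exists t.+2; rewrite [observed S t.+2]/= /force_step in_setU; apply/orP; right.
rewrite inE; apply/existsP; exists v; rewrite ht /= ?eqxx //.
apply/eqP/setP => x; rewrite !inE.
apply/andP/eqP => [[xt vx]|->]; last by [].
by apply: contraNeq xt => xw; apply: ht; rewrite /= vx xw orbT.
Qed.

Lemma monitored_pd_set {G : sgraph} (S : {set G}) :
  S != set0 -> (forall x, monitored S x) -> pd_set S.
Proof.
move=> S0 mS; rewrite /pd_set S0; apply/asboolP.
have [x _|t ht] := @monitored_uniform G S predT; first exact: mS.
by exists t.+1; apply/setP => x; rewrite in_setT ht.
Qed.

Definition fort {G : sgraph} (F : {set G}) : Prop :=
  forall v w, v \notin F -> w \in F -> edge v w ->
  exists w', [/\ w' \in F, edge v w' & w' != w].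

(** A fort can only be entered by domination: an observed vertex outside F
    with a neighbour in the unobserved F has two, so it forces neither. *)
Lemma fort_dominated {G : sgraph} (F S : {set G}) :
  fort F -> F != set0 -> pd_set S ->
  exists x y, [/\ x \in S, y \in F & y \in closed_nbhd x].
Proof.
move=> fF /set0Pn[z zF] /andP[_ /asboolP[t et]].
have [/existsP[x /existsP[y /and3P[xS yF xy]]]|nh] :=
  boolP [exists x, [exists y, [&& x \in S, y \in F & y \in closed_nbhd x]]].
  by exists x, y.
suff /(_ t): forall i x, x \in observed S i -> x \notin F.
  by move=> /(_ z); rewrite et in_setT zF => /(_ isT).
have dom x y : x \in S -> y \in closed_nbhd x -> y \notin F.
  move=> xS xy; apply: contraNN nh => yF.
  by apply/existsP; exists x; apply/existsP; exists y; apply/and3P.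
elim=> [|[|i] IH] x.
- by move=> /= xS; apply: (dom x) => //; apply: setU11.
- by move=> /= /bigcupP[y yS]; apply: dom.
rewrite [observed S i.+2]/= /force_step in_setU => /orP[|]; first exact: IH.
rewrite inE => /existsP[v /andP[vA /eqP e]]; apply/negP => xF.
have : x \in nbhd v :\: observed S i.+1 by rewrite e set11.
rewrite !inE => /andP[_ vx].
have [w [wF vw /eqP wx]] := fF v x (IH v vA) xF vx.
apply: wx; apply/set1P; rewrite -e inE [w \in nbhd v]inE vw andbT.
by apply: contraTN wF => /IH.
Qed.

(** * Paths in TAR graphs *)

Lemma TAR_connect_sym {G : sgraph} k : connect_sym (@edge (TAR G k)).
Proof. exact: sym_connect_sym (@edge_sym (TAR G k)). Qed.

Lemma TAR_connect_sub {G : sgraph} k (A B : TAR G k) :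
  val A \subset val B -> connect (@edge (TAR G k)) A B.
Proof.
have [m] := ubnP #|val B :\: val A|; elim: m A => // m IH A cA sAB.
have [/eqP|[x]] := set_0Vmem (val B :\: val A).
  rewrite setD_eq0 => sBA.
  suff -> : A = B by apply: connect0.
  by apply/val_inj/eqP; rewrite eqEsubset sAB.
rewrite inE => /andP[xA xB].
have sxB : x |: val A \subset val B by rewrite subUset sub1set xB.
have pA : pd_set (x |: val A) && (#|x |: val A| <= k).
  have /andP[pA _] := valP A; have /andP[_ Bk] := valP B.
  by rewrite (pd_setS (subsetUr _ _) pA) (leq_trans (subset_leq_card sxB)).
pose A' : TAR G k := exist _ (x |: val A) pA.
apply: (@connect_trans _ _ A').
  by apply/connect1/orP; left; apply/existsP; exists x; rewrite xA /=.
apply: (IH A' _ sxB); apply: leq_trans (ltnSE cA); apply: proper_card; apply/properP.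
split; first by apply: setDS; apply: subsetUr.
by exists x; rewrite !inE ?xA ?xB ?eqxx.
Qed.

Lemma TAR_connect_union {G : sgraph} k (A B : TAR G k) :
  #|val A :|: val B| <= k -> connect (@edge (TAR G k)) A B.
Proof.
move=> ABk.
have pU : pd_set (val A :|: val B) && (#|val A :|: val B| <= k).
  have /andP[pA _] := valP A.
  by rewrite ABk (pd_setS (subsetUl _ _) pA).
pose U : TAR G k := exist _ (val A :|: val B) pU.
apply: (@connect_trans _ _ U); last rewrite TAR_connect_sym;
  apply: TAR_connect_sub; [exact: subsetUl | exact: subsetUr].
Qed.

(** * Power dominating sets of G_n *)

Definition apexes (n : nat) : {set Gn n} :=
  [set x : Gn_vertex n | if x is inl _ then true else false].

(** Only the values on clique vertices matter; a total function into 'I_n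
    avoids an option type. *)
Definition clique_of (n : nat) (x : Gn n) : 'I_n :=
  match x with
  | inl j => widen_ord (leq_pred n) j
  | inr (i, _) => i
  end.

Definition cliques_met (n : nat) (S : {set Gn n}) : {set 'I_n} :=
  [set clique_of n x | x in S :\: apexes n].

Lemma cliques_metP n (S : {set Gn n}) i :
  reflect (exists j, (inr (i, j) : Gn n) \in S) (i \in cliques_met n S).
Proof.
apply: (iffP imsetP) => [[[j|[r j]]]|[j ij]].
- by rewrite !inE.
- by rewrite inE => /andP[_ rj] ->; exists j.
- by exists (inr (i, j)) => //; rewrite !inE ij.
Qed.

Lemma card_apexes n : #|apexes n| = n.-1.
Proof.
rewrite -[RHS]card_ord -(card_imset predT (@inl_inj _ ('I_n * 'I_n)%type)).
apply: eq_card => x; rewrite inE.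
case: x => [j|x]; first by rewrite imset_f.
by apply/esym/imsetP => -[].
Qed.

(** An apex accounts for no clique, and any other vertex for only one. *)
Lemma card_apexesI n (S : {set Gn n}) :
  #|S :&: apexes n| + #|cliques_met n S| <= #|S|.
Proof. by rewrite -(cardsID (apexes n) S) leq_add2l leq_imset_card. Qed.

(** The last vertex of a clique has no apex; the first vertex of the clique
    forces it.  Both kinds of power dominating sets need this final step. *)
Lemma clique_monitored n (hn : 3 <= n) (S : {set Gn n}) (i : 'I_n) :
  (forall j : 'I_n.-1, monitored (G := Gn n) S (inl j)) ->
  (forall j : 'I_n, j < n.-1 -> monitored (G := Gn n) S (inr (i, j))) ->
  forall j : 'I_n, monitored (G := Gn n) S (inr (i, j)).
Proof.
move=> mu mv j; have [/mv //|jn] := ltnP j n.-1.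
have n0 : 0 < n by lia.
apply: (@monitored_force (Gn n) S (inr (i, Ordinal n0))).
- by apply: mv => /=; lia.
- by rewrite /= eqxx /= -val_eqE /=; lia.
case=> [l _ _|[r p]]; first exact: mu.
rewrite /= => /andP[/eqP <- _] pj; apply: mv.
have pj' : p != j by apply: contraNneq pj => ->.
by move: pj'; rewrite -val_eqE /=; have := ltn_ord p; have := ltn_ord j; lia.
Qed.

Lemma apexes_pd_set n (hn : 3 <= n) : pd_set (apexes n).
Proof.
apply: monitored_pd_set; first by rewrite -card_gt0 card_apexes; lia.
have mu (j : 'I_n.-1) : monitored (G := Gn n) (apexes n) (inl j).
  by apply: (@monitored_dom (Gn n) _ _ (inl j)); rewrite ?setU11 // inE.
case=> [//|[i j]]; apply: clique_monitored => // {}j jn.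
apply: (@monitored_dom (Gn n) _ _ (inl (Ordinal jn))); rewrite !inE //=.
Qed.

Lemma cliques_met_pd_set n (hn : 3 <= n) (S : {set Gn n}) :
  n.-1 <= #|cliques_met n S| -> pd_set S.
Proof.
move=> hS.
have [i0 i0S] : exists i0, i0 \in cliques_met n S.
  by apply/set0Pn; rewrite -card_gt0; lia.
have mv i j : i \in cliques_met n S -> monitored (G := Gn n) S (inr (i, j)).
  case/cliques_metP => p ip; apply: (@monitored_dom _ _ _ _ ip).
  rewrite !inE /= eqxx /=.
  by have [->|pj] := eqVneq p j; rewrite ?eqxx ?orbT.
have mu (j : 'I_n.-1) : monitored (G := Gn n) S (inl j).
  apply: (@monitored_force (Gn n) S (inr (i0, widen_ord (leq_pred n) j))).
  - exact: mv.
  - by rewrite /=.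
  case=> [l /= /eqP jl /eqP []|[r p] /= /andP[/eqP <- _] _]; last exact: mv.
  by congr inl; apply/val_inj.
apply: monitored_pd_set.
  by case/cliques_metP: i0S => j ij; apply/set0Pn; exists (inr (i0, j)).
case=> [//|[i j]]; have [/mv //|iS] := boolP (i \in cliques_met n S).
apply: clique_monitored => // {}j jn.
apply: (@monitored_force (Gn n) S (inl (Ordinal jn))) => //=.
case=> [//|[r p]] /= /eqP jp rp; apply: mv.
have ri : r != i.
  apply: contraNneq rp => ->; apply/eqP; congr (inr (_, _)).
  by apply/val_inj; rewrite /= jp.
have : #|~: cliques_met n S| <= 1.
  by have := cardsC (cliques_met n S); rewrite card_ord; lia.
move/card_le1_eqP => h; apply: contraNT ri => rS.
by apply/eqP; apply: h; rewrite inE.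
Qed.

Definition Gn_fort (n : nat) (r s : 'I_n) (a : 'I_n.-1) : {set Gn n} :=
  [set x : Gn_vertex n | if x is inr (i, j)
     then ((i == r) || (i == s)) && ((j == a :> nat) || (j == n.-1 :> nat))
     else false].

(** An apex reaches the fort only in column a, and there in both cliques; a
    clique vertex reaches it in both columns of its own clique. *)
Lemma Gn_fortP n (r s : 'I_n) (a : 'I_n.-1) :
  r != s -> fort (Gn_fort n r s a).
Proof.
move=> rs v [j|[i j]] vF; first by rewrite inE.
rewrite inE => /andP[ihyp jhyp].
have an := ltn_ord a.
have n0 : n.-1 < n by have := ltn_ord r; lia.
case: v vF => [l _ /= /eqP lj|[p l] vF /= /andP[/eqP pi lj]].
  exists (inr (if i == r then s else r, j)); rewrite inE /=; split.
  - by rewrite jhyp andbT; case: ifP; rewrite eqxx ?orbT.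
  - exact/eqP.
  - apply/eqP => -[]; case: eqP => [-> /eqP|ir ri]; last by case: ir.
    by rewrite eq_sym (negPf rs).
pose j' : 'I_n := if j == a :> nat then Ordinal n0 else widen_ord (leq_pred n) a.
have j'h : (j' == a :> nat) || (j' == n.-1 :> nat).
  by rewrite /j'; case: ifP => _ /=; rewrite eqxx ?orbT.
exists (inr (i, j')); rewrite inE /=; split.
- by rewrite ihyp.
- rewrite pi eqxx /=; apply: contraNneq vF => ->.
  by rewrite inE pi ihyp.
- apply/eqP => -[] /(congr1 val); move: jhyp; rewrite /j'.
  by case: eqP => /=; lia.
Qed.

Lemma Gn_pd_setE n (hn : 3 <= n) (S : {set Gn n}) :
  pd_set S = (apexes n \subset S) || (n.-1 <= #|cliques_met n S|).
Proof.
apply/idP/orP => [pS|[sS|]]; last 2 first.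
- exact: pd_setS sS (apexes_pd_set n hn).
- exact: cliques_met_pd_set.
have [|few] := leqP n.-1 #|cliques_met n S|; [by right | left].
apply/subsetP => -[a _|x]; last by rewrite inE.
apply/negPn/negP => aS.
have : 1 < #|~: cliques_met n S|.
  by have := cardsC (cliques_met n S); rewrite card_ord; lia.
case/card_gt1P => r [s [rS sS rs]]; rewrite !inE in rS sS.
have n0 : n.-1 < n by lia.
have F0 : Gn_fort n r s a != set0.
  by apply/set0Pn; exists (inr (r, Ordinal n0)); rewrite inE !eqxx orbT.
have [x [y [xS yF xy]]] := fort_dominated _ _ (Gn_fortP n r s a rs) F0 pS.
case: y yF xy => [j|[i j]]; rewrite inE // => /andP[irs ja].
have iS : i \notin cliques_met n S by case/orP: irs => /eqP ->.
have an := ltn_ord a.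
case: x xS => [l lS|[p l] pS']; rewrite !inE /=.
  move=> /eqP lj; case/negP: aS; suff -> : a = l by [].
  by apply/val_inj => /=; have := ltn_ord l; move: ja => /orP[]/eqP; lia.
case/orP=> [/eqP[ip _]|/andP[/eqP ip _]]; case/cliques_metP: iS; exists l.
  by rewrite ip.
by rewrite -ip.
Qed.

Lemma Gn_pd_set_geq n (hn : 3 <= n) (S : {set Gn n}) : pd_set S -> n.-1 <= #|S|.
Proof.
rewrite Gn_pd_setE // => /orP[/subset_leq_card|hS]; first by rewrite card_apexes.
by have := card_apexesI n S; lia.
Qed.

(** A set that meets n - 1 cliques is thinned out to one vertex in each of
    them. *)
Lemma Gn_pd_set_core n (hn : 3 <= n) (S : {set Gn n}) :
  pd_set S -> exists M : {set Gn n}, [/\ M \subset S, pd_set M & #|M| = n.-1].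
Proof.
move=> pS; have := pS; rewrite Gn_pd_setE // => /orP[sS|hS].
  by exists (apexes n); rewrite card_apexes apexes_pd_set.
have : 0 < #|[set H : {set 'I_n} | H \subset cliques_met n S & #|H| == n.-1]|.
  by rewrite cards_draws bin_gt0.
rewrite card_gt0 => /set0Pn[H]; rewrite inE => /andP[sH /eqP cH].
(* The default v^i_i keeps [clique_of] a left inverse of f on all of 'I_n. *)
pose f (i : 'I_n) : Gn n :=
  inr (i, odflt i [pick j | (inr (i, j) : Gn n) \in S]).
have fK : cancel f (clique_of n) by [].
have cM : #|f @: H| = n.-1 by rewrite card_imset //; apply: can_inj fK.
exists (f @: H); split=> //.
  apply/subsetP => _ /imsetP[i /(subsetP sH)/cliques_metP[j ij] ->].
  by rewrite /f; case: pickP => [//|/(_ j)]; rewrite ij.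
apply: cliques_met_pd_set => //; rewrite -cH; apply/subset_leq_card/subsetP.
move=> i iH; apply/cliques_metP.
by exists (odflt i [pick j | (inr (i, j) : Gn n) \in S]); apply: (imset_f f).
Qed.

Lemma gammaP_Gn n (hn : 3 <= n) : gammaP (Gn n) = n.-1.
Proof.
have pA := apexes_pd_set n hn.
rewrite /gammaP; case: arg_minnP => [|S pS minS].
  exact: pd_setS (subsetT _) pA.
apply/eqP; rewrite eqn_leq Gn_pd_set_geq // andbT -(card_apexes n).
exact: minS.
Qed.

Lemma upper_gammaP_Gn n (hn : 3 <= n) : upper_gammaP (Gn n) = n.-1.
Proof.
have cmin (S : {set Gn n}) : minset (@pd_set (Gn n)) S -> #|S| = n.-1.
  move=> mS; have [M [sM pM <-]] := Gn_pd_set_core n hn S (minsetp mS).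
  by rewrite (minsetinf mS pM sM).
have [M mM _] := minset_exists (apexes_pd_set n hn).
apply/eqP; rewrite eqn_leq; apply/andP; split.
  by apply/bigmax_leqP => S /cmin ->.
by rewrite -(cmin M mM); apply: leq_bigmax_cond.
Qed.

(** * Connectedness of the TAR graphs of G_n *)

Lemma TAR_Gn_connected n (hn : 3 <= n) k :
  2 * n - 2 <= k -> connected_graph (TAR (Gn n) k).
Proof.
move=> hk.
have pT : pd_set (apexes n) && (#|apexes n| <= k).
  by rewrite apexes_pd_set // card_apexes; lia.
pose T : TAR (Gn n) k := exist _ (apexes n) pT.
have toT (A : TAR (Gn n) k) : connect (@edge (TAR (Gn n) k)) A T.
  have /andP[pA _] := valP A; have [M [sM pM cM]] := Gn_pd_set_core n hn _ pA.
  have pM' : pd_set M && (#|M| <= k) by rewrite pM; lia.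
  pose M' : TAR (Gn n) k := exist _ M pM'.
  apply: (@connect_trans _ _ M').
    by rewrite TAR_connect_sym; apply: TAR_connect_sub.
  apply: TAR_connect_union; rewrite /= cardsU cM card_apexes; lia.
apply/'forall_forallP => A B; apply: (connect_trans (toT A)).
by rewrite TAR_connect_sym; apply: toT.
Qed.

(** Below the threshold the sets that contain T_n are closed under adjacency:
    removing an apex would require n - 1 further vertices, one in each of
    n - 1 cliques. *)
Lemma TAR_Gn_disconnected n (hn : 3 <= n) k :
  n.-1 <= k -> k < 2 * n - 2 -> ~~ connected_graph (TAR (Gn n) k).
Proof.
move=> nk kn; apply/negP => /'forall_forallP conn.
have pT : pd_set (apexes n) && (#|apexes n| <= k).
  by rewrite apexes_pd_set // card_apexes.
pose T : TAR (Gn n) k := exist _ (apexes n) pT.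
have p0 : pd_set (~: apexes n).
  apply: cliques_met_pd_set => //.
  suff -> : cliques_met n (~: apexes n) = setT by rewrite cardsT card_ord leq_pred.
  by apply/setP => i; rewrite in_setT; apply/cliques_metP; exists i; rewrite !inE.
have [M [sM pM cM]] := Gn_pd_set_core n hn _ p0.
have pM' : pd_set M && (#|M| <= k) by rewrite pM cM.
pose M' : TAR (Gn n) k := exist _ M pM'.
have cl : closed (@edge (TAR (Gn n) k))
    [pred A : TAR (Gn n) k | apexes n \subset val A].
  apply: intro_closed; first exact: TAR_connect_sym.
  move=> A B AB; rewrite !inE => sA.
  case/orP: AB => /existsP[x /andP[xA /eqP eB]]; rewrite ?eB.
    exact: subset_trans sA (subsetUr _ _).
  have /andP[pB _] := valP B; have /andP[_ cA] := valP A.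
  apply/negPn/negP => sB.
  have := card_apexesI n (val A); rewrite (setIidPr sA) card_apexes => cI.
  suff : n.-1 <= #|cliques_met n (val A)| by lia.
  move: pB; rewrite Gn_pd_setE // eB (negPf sB) /= => /leq_trans; apply.
  exact/subset_leq_card/imsetS/setSD/subD1set.
have := closed_connect cl (conn T M'); rewrite !inE /= subxx => /esym sT.
have n1 : 0 < n.-1 by lia.
have /(subsetP sT)/(subsetP sM) : (inl (Ordinal n1) : Gn n) \in apexes n.
  by rewrite inE.
by rewrite !inE.
Qed.

Theorem theorem3p12 (n : nat) (hn : 3 <= n) :
  [/\ upper_gammaP (Gn n) = gammaP (Gn n),
      gammaP (Gn n) = n - 1,
      lower_pd0 (Gn n) = pd0 (Gn n),
      pd0 (Gn n) = 2 * n - 2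
    & 2 * n - 2 > upper_gammaP (Gn n) + 1
      /\ upper_gammaP (Gn n) + 1 = gammaP (Gn n) + 1].
Proof.
have g := gammaP_Gn n hn; have ug := upper_gammaP_Gn n hn.
have thr k : n.-1 <= k -> connected_graph (TAR (Gn n) k) -> 2 * n - 2 <= k.
  move=> nk; apply: contraTT; rewrite -ltnNge.
  exact: TAR_Gn_disconnected.
have lo : lower_pd0 (Gn n) = 2 * n - 2.
  rewrite /lower_pd0; case: ex_minnP => m; rewrite g => /andP[nm cm] minm.
  apply/eqP; rewrite eqn_leq thr // andbT; apply: minm.
  by rewrite TAR_Gn_connected // andbT; lia.
have hi : pd0 (Gn n) = 2 * n - 2.
  rewrite /pd0; case: ex_minnP => m; rewrite g => /andP[nm /asboolP cm] minm.
  apply/eqP; rewrite eqn_leq thr ?cm // andbT; apply: minm.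
  apply/andP; split; first lia.
  by apply/asboolP => k; apply: TAR_Gn_connected.
by rewrite lo hi g ug; split=> //; [|split]; lia.
Qed.
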